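(* Let $i\in\{3\frac{1}{2},4,5\}$, or let $i=6$ and assume Martin's Axiom together with the negation of the Continuum Hypothesis. A locally connected $T_i$-space $X$ has a $T_i$ one-point connectification if and only if $X$ has no compact component.
   Context: Conventions: $T_{3\frac12}$ = completely regular and $T_1$; $T_4$ = normal and $T_1$; $T_5$ = hereditarily normal (every subspace normal) and $T_1$; $T_6$ = perfectly normal, i.e. normal, $T_1$, and every closed subset is a $G_\delta$-set. A one-point connectification of a space $X$ is a connected space $Y$ which contains $X$ as a dense subspace and such that $Y\setminus X$ is a singleton. Components are the maximal connected subspaces. *)

(* Defs.v *)
From HB Require Import structures.
From mathcomp Require Import all_boot all_order all_algebra.
From mathcomp Require Import all_classical all_reals all_analysis.
Set Implicit Arguments. Unset Strict Implicit. Unset Printing Implicit Defensive.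
Import Order.TTheory GRing.Theory Num.Theory.
Local Open Scope classical_set_scope.

Inductive sep_index := T3half | T4 | T5 | T6.

(* T_1 is the library's [accessible_space]. *)
Definition Gdelta (X : topologicalType) (A : set X) : Prop :=
  exists F : nat -> set X, (forall n, open (F n)) /\ A = \bigcap_n F n.

Definition Ti_space (i : sep_index) (X : topologicalType) : Prop :=
  match i with
  | T3half => completely_regular_space X /\ accessible_space X
  | T4 => normal_space X /\ accessible_space X
  | T5 => (forall A : set X, normal_space (subspace A)) /\ accessible_space X
  | T6 => [/\ normal_space X, accessible_space X &
             forall A : set X, closed A -> Gdelta A]
  end.

Definition locally_connected_space (X : topologicalType) : Prop :=
  forall (x : X) (U : set X), nbhs x U ->
    exists V : set X, [/\ open V, V x, connected V & V `<=` U].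

Definition embedding (X Y : topologicalType) (e : X -> Y) : Prop :=
  [/\ injective e, continuous e &
      forall U : set X, open U ->
        exists2 V : set Y, open V & e @` U = V `&` range e].

Definition one_point_connectification (X Y : topologicalType) (e : X -> Y)
  : Prop :=
  [/\ embedding e, dense (range e), (exists p : Y, ~` range e = [set p])
    & connected [set: Y]].

Definition has_Ti_one_point_connectification (i : sep_index)
  (X : topologicalType) : Prop :=
  exists (Y : topologicalType) (e : X -> Y),
    one_point_connectification e /\ Ti_space i Y.

Definition no_compact_component (X : topologicalType) : Prop :=
  forall x : X, ~ compact (connected_component [set: X] x).

Local Open Scope card_scope.

(* forcing posets: [le p q] means p is stronger than (extends) q *)
Record forcing_poset := ForcingPoset {
  fp_carrier :> Type;
  fp_le : fp_carrier -> fp_carrier -> Prop;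
  fp_refl : forall p, fp_le p p;
  fp_trans : forall p q r, fp_le p q -> fp_le q r -> fp_le p r;
  fp_antisym : forall p q, fp_le p q -> fp_le q p -> p = q }.

Definition compatible (P : forcing_poset) (p q : P) : Prop :=
  exists r : P, fp_le r p /\ fp_le r q.

Definition antichain (P : forcing_poset) (A : set P) : Prop :=
  forall p q, A p -> A q -> p <> q -> ~ compatible p q.

Definition ccc (P : forcing_poset) : Prop :=
  forall A : set P, antichain A -> countable A.

Definition dense_in (P : forcing_poset) (D : set P) : Prop :=
  forall p : P, exists2 q, D q & fp_le q p.

Definition poset_filter (P : forcing_poset) (G : set P) : Prop :=
  [/\ G !=set0,
      (forall p q, G p -> fp_le p q -> G q) &
      (forall p q, G p -> G q -> exists2 r, G r & fp_le r p /\ fp_le r q)].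

Definition card_lt_continuum (I : Type) : Prop :=
  [set: I] #<= [set: nat -> bool] /\ ~ ([set: nat -> bool] #<= [set: I]).

Definition MartinsAxiom : Prop :=
  forall (P : forcing_poset) (I : Type) (D : I -> set P),
    (exists p : P, True) -> ccc P -> card_lt_continuum I ->
    (forall j, dense_in (D j)) ->
    exists G : set P, poset_filter G /\ forall j, G `&` D j !=set0.

Definition notCH : Prop :=
  exists A : set (nat -> bool),
    ~ countable A /\ ~ ([set: nat -> bool] #<= A).

(* Main.v *)
Require Import Defs.
From HB Require Import structures.
From mathcomp Require Import all_boot all_order all_algebra finmap.
From mathcomp Require Import all_classical all_reals all_analysis wochoice.
From mathcomp Require Import Rstruct lra.
Set Implicit Arguments. Unset Strict Implicit.
Unset Printing Implicit Defensive.
Import Order.TTheory GRing.Theory Num.Theory numFieldNormedType.Exports.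
Local Open Scope classical_set_scope.

(** A compact component would be open (local connectedness) and compact, hence
    clopen, in a Hausdorff connectification.

    Conversely, choose on each component a proper filter without cluster point
    and let [G] consist of the sets lying in all these filters.  The sets
    containing [{x | |f x| < 1}] for some continuous [f] tending to [0] along
    [G] are the traces of the neighbourhoods of a point added to [X]; the
    resulting space is connected since [G] meets every component, and the
    functions [f] make complete regularity, normality and hereditary normality
    pass from [X] to the extension.  For perfect normality [G] must moreover
    carry a positive continuous function tending to [0], that is, each component
    must carry a positive continuous function with infimum [0].

    By Tietze such a function exists unless the component is countably compact,
    and under MA and not CH a countably compact perfectly normal space is
    compact (Weiss).  For the latter, a cover without countable subcover is
    reduced to a closed set [E] covered by open sets [V_a], [a] in a well-order
    of type [omega_1], but by no countable subfamily of their closures.  If the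
    closure of some countable [D] in [E] has this property too, a
    pseudo-intersection of the traces on [D] of the complements of the closures
    (MA) is an infinite set clustering outside all [V_a].  Otherwise a
    recursion yields an uncountable discrete subset, impossible in a countably
    compact space whose open sets are F_sigma. *)

(** * Martin's axiom and cardinality *)

Lemma countable_inj (T U : Type) (f : T -> U) (A : set T) (B : set U) :
  {in A &, injective f} -> f @` A `<=` B -> countable B -> countable A.
Proof.
move=> finj fAB /countable_injP[g ginj]; apply/countable_injP; exists (g \o f).
move=> x y xA yA /= e; apply: finj => //; apply: ginj => //; apply: mem_set.
  by apply: fAB; exists x => //; exact: set_mem.
by apply: fAB; exists y => //; exact: set_mem.
Qed.

(** A set witnessing the failure of CH is well-ordered and cut at the least point with uncountably
    many predecessors, or kept whole if there is none. Its size stays below the continuum because it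
    lies in that set. *)
Lemma notCH_omega1_like : notCH ->
  exists (I : choiceType) (lt : I -> I -> Prop),
    [/\ well_founded lt, forall a b, [\/ a = b, lt a b | lt b a],
        forall a, countable [set b | lt b a], ~ countable [set: I] &
        card_lt_continuum I].
Proof.
case=> A [ncA ncontA]; have [R Rwo] := well_ordering_principle (nat -> bool).
pose lt (x y : nat -> bool) := R x y && (x != y).
have total x y : [\/ x = y, lt x y | lt y x].
  have /orP Rxy := wo_chainW (withinW Rwo) (in_setT x) (in_setT y).
  by have [->|xy] := eqVneq x y; [constructor 1|
    case: Rxy => Rxy; [constructor 2|constructor 3];
    rewrite /lt Rxy //= eq_sym].
have minP (P : set (nat -> bool)) : P !=set0 ->
    exists2 z, P z & forall y, P y -> ~ lt y z.
  move=> [x Px]; have [|z [[Pz zmin] _]] := Rwo (mem P).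
    by exists x; rewrite inE.
  move: Pz; rewrite inE => Pz; exists z => // y Py /andP[Ryz yz].
  have Rzy := zmin y (mem_set Py).
  (* Antisymmetry of [R] comes from uniqueness of least elements: [y] and [z] would both be least in
     the pair. *)
  have Ry : R y y.
    by have /orP[] := wo_chainW (withinW Rwo) (in_setT y) (in_setT y).
  have Rz : R z z.
    by have /orP[] := wo_chainW (withinW Rwo) (in_setT z) (in_setT z).
  have [|w [_ wU]] := Rwo (mem [set y; z]).
    by exists y; rewrite inE; left.
  move/eqP: yz; apply; rewrite -(wU y) ?(wU z) //; split;
    rewrite ?inE; [by right| |by left|]; by move=> u; rewrite inE => -[] ->.
have [B [BA ncB cB]] : exists B, [/\ B `<=` A, ~ countable B &
    forall a, B a -> countable [set b | B b /\ lt b a]].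
  have [[a ncAa]|/forallNP h] :=
      pselect (exists a, A a /\ ~ countable [set b | A b /\ lt b a]).
    have [a' [_ nca'] mina'] := minP [set a | A a /\
      ~ countable [set b | A b /\ lt b a]] (ex_intro _ a ncAa).
    exists [set b | A b /\ lt b a']; split=> // [b []//|b [Ab ltb]].
    apply: contrapT => nc; apply: (mina' b) => //; split=> // cb.
    apply: nc; apply: sub_countable cb; apply: subset_card_le.
    by move=> y [[]].
  exists A; split=> // a Aa; apply: contrapT => nc; exact: (h a).
have valI (b : B) : B (val b) by exact: set_valP.
exists (set_type B), (fun a b : B => lt (val a) (val b)); split.
- move=> a; apply: contrapT => na.
  have [|z [c nc <-] minz] := minP (val @` [set c : B |
    ~ Acc (fun a b : B => lt (val a) (val b)) c]); first by exists (val a), a.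
  apply: nc; constructor => y yc; apply: contrapT => ny.
  by apply: (minz (val y)) => //; exists y.
- move=> a b; have [ab|ab|ab] := total (val a) (val b).
  + by constructor 1; exact: val_inj.
  + by constructor 2.
  + by constructor 3.
- move=> a; apply: countable_inj (cB _ (valI a)); last first.
    by move=> _ [b /= ab <-]; split.
  by move=> x y _ _; exact: val_inj.
- by rewrite (eq_countable (card_setT B)).
- split; first by rewrite (card_le_eql (card_setT B)); exact: card_leT.
  rewrite (card_le_eqr (card_setT B)) => h; apply: ncontA.
  apply: card_le_trans h _; exact: subset_card_le.
Qed.

(** Well-founded recursion: only countably many values precede stage [a], so the hypothesis on
    countable sets always supplies the next one. *)
Lemma wf_countable_choice (I T : Type) (lt : I -> I -> Prop)
    (Q : set T -> T -> Prop) :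
  well_founded lt -> (forall a, countable [set b | lt b a]) ->
  (forall S : set T, countable S -> exists y, Q S y) ->
  exists x : I -> T, forall a, Q (x @` [set b | lt b a]) (x a).
Proof.
move=> wf clt HQ.
have /choice[c cP] : forall S, exists y, countable S -> Q S y.
  move=> S; have [/HQ[y Qy]|nS] := pselect (countable S); first by exists y.
  by have [y _] := HQ set0 (countable0 T); exists y.
pose step a (f : forall b, lt b a -> T) := c [set y | exists b h, f b h = y].
pose x := Fix wf (fun=> T) step.
exists x => a; have -> : x a = c (x @` [set b | lt b a]).
  rewrite {1}/x Fix_eq; last first.
    by move=> i f g fg; congr c; rewrite predeqE => y; split=> -[b [h e]];
      exists b, h; rewrite -e fg.
  congr c; rewrite predeqE => y; split=> [[b [h <-]]|[b h <-]].
    by exists b.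
  by exists b, h.
apply: cP; apply: sub_countable (clt a); exact: card_image_le.
Qed.

Lemma infinite_set_inj (J : Type) (A : set J) :
  infinite_set A -> exists2 e : nat -> J, injective e & forall k, A (e k).
Proof.
elim/Ppointed: J => J in A *.
  by rewrite emptyE_subdef => /infinite_setN0[].
move/infiniteP/pcard_leP => [f]; exists f.
  by move=> m n; apply: inj; exact: in_setT.
by move=> k; exact: funS.
Qed.

(** Such a map lets the index set [J] also number the size requirements in the forcing argument
    below. *)
Lemma infinite_set_surj (J : Type) :
  infinite_set [set: J] -> exists h : J -> nat, forall n, exists j, h j = n.
Proof.
move=> /infinite_set_inj[e einj _].
exists (fun j => xget 0%N [set n | e n = j]) => n; exists (e n).
by apply: einj; apply: (@xgetPex _ 0%N [set m | e m = e n]); exists n.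
Qed.

Section pseudo_intersection.
Local Open Scope fset_scope.
Variables (J : choiceType) (B : J -> set nat).

(* A finite approximation [p.1] of the pseudo-intersection, with the promise
   that later elements lie in [B j] for [j] in [p.2]. *)
Let le (p q : {fset nat} * {fset J}) : Prop :=
  [/\ q.1 `<=` p.1, q.2 `<=` p.2 &
      forall n j, n \in p.1 -> n \notin q.1 -> j \in q.2 -> B j n].

Let le_refl p : le p p.
Proof. by split=> // n j ->. Qed.

Let le_trans p q r : le p q -> le q r -> le p r.
Proof.
move=> [s1 t1 H1] [s2 t2 H2]; split.
- exact: fsubset_trans s2 s1.
- exact: fsubset_trans t2 t1.
move=> n j np nr jr; have [nq|nq] := boolP (n \in q.1); first exact: H2.
by apply: H1 => //; apply: (fsubsetP t2).
Qed.

Let le_antisym p q : le p q -> le q p -> p = q.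
Proof.
move: p q => [s t] [s' t'] [/= s1 t1 _] [/= s2 t2 _].
by congr pair; apply/eqP; rewrite eqEfsubset ?s1 ?s2 ?t1 ?t2.
Qed.

Let P : forcing_poset := ForcingPoset le_refl le_trans le_antisym.

(* Conditions with the same first component are compatible. *)
Let ccc_P : ccc P.
Proof.
move=> A antiA; apply: (@countable_inj _ _ (fun p : P => p.1) _ setT);
  [|by []|exact: countableP].
move=> p q /set_mem Ap /set_mem Aq pq; apply: contrapT => npq.
apply: (antiA p q Ap Aq npq); exists (p.1, p.2 `|` q.2).
split; split=> /=.
- exact: fsubset_refl.
- exact: fsubsetUl.
- by move=> n j ->.
- by rewrite pq fsubset_refl.
- exact: fsubsetUr.
- by move=> n j; rewrite pq => ->.
Qed.

Lemma MA_pseudo_intersection :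
  MartinsAxiom -> card_lt_continuum J -> infinite_set [set: J] ->
  (forall t : {fset J},
     infinite_set [set n | forall j, j \in t -> B j n]) ->
  exists E, infinite_set E /\ forall j, finite_set (E `\` B j)%classic.
Proof.
move=> MA cJ /infinite_set_surj[h hsurj] HB.
(* [D j] makes the promise [j] and asks for at least [h j] elements; as [h] is onto, the union of
   the first components along the filter is infinite. *)
pose D j : set P := [set p | j \in p.2 /\ (h j <= #|` p.1|)%N].
have [|j|G [[_ _ dirG] GD]] := MA P J D _ ccc_P cJ.
- by exists (fset0, fset0).
- move=> p; have [X XB cX] := infinite_set_fset (h j) (HB p.2).
  exists (p.1 `|` X, j |` p.2); [split=> /=|split=> /=].
  + by rewrite fset1U1.
  + by apply: leq_trans cX _; apply: fsubset_leq_card; exact: fsubsetUr.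
  + exact: fsubsetUl.
  + exact: fsubsetUr.
  + move=> n i; rewrite inE => /orP[->//|nX] _ ip; exact: XB.
exists [set n | exists2 p, G p & n \in p.1]; split.
  move=> /finite_fsetP[X EX]; have [j hj] := hsurj #|` X|.+1.
  have [p [Gp [_ hp]]] := GD j; move: hp; rewrite hj ltnNge => /negP; apply.
  apply: fsubset_leq_card; apply/fsubsetP => n np.
  have : [set n | exists2 p, G p & n \in p.1]%classic n by exists p.
  by rewrite EX.
move=> j; have [p [Gp [jp _]]] := GD j.
apply: sub_finite_set (finite_fset p.1) => n [[q Gq nq] nB] /=.
(* A common extension [r] contains every [n] of [q.1]; if [n] is outside [p.1], the promise [j] of
   [p] places it in [B j]. *)
have [r _ [[_ _ Hrp] [qr _ _]]] := dirG _ _ Gp Gq.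
apply: contrapT => /negP np; apply: nB; apply: (Hrp n j) => //.
exact: (fsubsetP qr).
Qed.

End pseudo_intersection.

Lemma countable_range (T : Type) (S : set T) :
  countable S -> S !=set0 -> exists s : nat -> T, S = range s.
Proof.
move=> /countable_injP[f finj] [x0 Sx0].
have /choice[s sP] : forall n, exists z, S z /\
    forall w, S w -> f w = n -> z = w.
  move=> n; have [[w [Sw fw]]|/forallNP h] :=
    pselect (exists w, S w /\ f w = n).
    exists w; split=> // w' Sw' fw'; apply: finj; rewrite ?inE //.
    by rewrite fw fw'.
  by exists x0; split=> // w Sw fw; case: (h w).
exists s; rewrite predeqE => z; split=> [Sz|[n _ <-]]; last by case: (sP n).
by exists (f z) => //; have [_] := sP (f z); exact.
Qed.

Lemma countable_setU (T : Type) (A B : set T) :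
  countable A -> countable B -> countable (A `|` B).
Proof.
move=> cA cB; rewrite -bigcup2E.
by apply: bigcup_countable => // -[|[|i]] _ //=.
Qed.

Lemma finite_set_nat_bound (A : set nat) :
  finite_set A -> exists N, forall n, A n -> (n < N)%N.
Proof.
move=> /finite_fsetP[Y ->]; exists (\max_(n <- enum_fset Y) n).+1 => n nY.
rewrite ltnS; exact: (@leq_bigmax_seq _ _ xpredT id).
Qed.

(** * Countably compact spaces *)

Section countably_compact.
Variable X : topologicalType.
Implicit Types (C : set X) (d : nat -> X).

Definition seq_cluster d (z : X) :=
  forall U, open U -> U z -> forall n, exists2 m, (n <= m)%N & U (d m).

Definition countably_compact C :=
  forall d, (forall n, C (d n)) -> exists2 z, C z & seq_cluster d z.

Definition open_Fsigma := forall O : set X, open O ->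
  exists2 K : nat -> set X, forall n, closed (K n) & O = \bigcup_n K n.

Lemma seq_cluster_closed C d z :
  closed C -> (forall n, C (d n)) -> seq_cluster d z -> C z.
Proof.
move=> clC dC dz; apply: contrapT => nCz.
by have [m _ /(_ (dC m))] := dz _ (closed_openC clC) nCz 0%N.
Qed.

(* The open neighbourhood of the discrete set is an F_sigma, so one of its
   closed pieces contains an infinite, hence clustering, part of it. *)
Lemma discrete_countable C (J : Type) (y : J -> X) (V : J -> set X) :
  open_Fsigma -> countably_compact C -> (forall j, C (y j)) ->
  (forall j, open (V j)) -> (forall j, V j (y j)) ->
  (forall i j, V i (y j) -> i = j) -> countable [set: J].
Proof.
move=> Fs ccC yC oV Vy Vinj; apply: contrapT => ncJ.
have [K clK OK] := Fs _ (bigcup_open (fun j (_ : setT j) => oV j)).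
have [n ncn] : exists n, ~ countable [set j | K n (y j)].
  apply: contrapT => /forallNP h; apply: ncJ.
  have -> : [set: J] = \bigcup_n [set j | K n (y j)].
    rewrite predeqE => j; split=> // _.
    have : (\bigcup_j V j) (y j) by exists j.
    by rewrite OK => -[n _ ?]; exists n.
  apply: bigcup_countable => // n _; apply: contrapT; exact: h.
have [|e einj eK] := @infinite_set_inj _ [set j | K n (y j)].
  by move/finite_set_countable.
have [z Cz dz] := ccC (y \o e) (fun k => yC _).
have : (\bigcup_n K n) z by exists n => //; exact: seq_cluster_closed dz.
rewrite -OK => -[i _ Viz].
have [m _ /Vinj im] := dz _ (oV i) Viz 0%N.
have [m' mm' /Vinj im'] := dz _ (oV i) Viz m.+1.
by move: mm'; rewrite (einj m' m) ?ltnn // -im -im'.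
Qed.

(** Take a filter containing [C] without cluster point in [C], and let [U z] be a neighbourhood of
    [z] whose complement is in the filter. If countably many [U z] covered [C], points [d n]
    avoiding the first [n] of them would have a cluster point in none of them. Regularity shrinks
    [U] to [V]. *)
Lemma not_compact_cover C : regular_space X -> countably_compact C ->
  ~ compact C -> exists U V : X -> set X,
    [/\ forall z, open (V z), forall z, C z -> V z z,
        forall z, closure (V z) `<=` U z &
        forall S, countable S -> exists y, C y /\ forall z, S z -> ~ U z y].
Proof.
move=> regX ccC /existsNP[F /not_implyP[PF /not_implyP[FC /set0P/negP]]].
rewrite negbK => /eqP CF0.
have /choice[U UP] : forall z, exists U, [/\ open U, C z -> U z & F (~` U)].
  move=> z; have [Cz|nCz] := pselect (C z); last first.
    by exists set0; split=> //; [exact: open0|rewrite setC0; exact: filterT].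
  have /existsNP[A /existsNP[B]] : ~ cluster F z.
    by move=> Fz; have : (C `&` cluster F) z by []; rewrite CF0.
  move=> /not_implyP[FA /not_implyP[+ AB]].
  rewrite nbhsE => -[W [oW Wz] WB]; exists W; split=> //.
  apply: filterS FA => x Ax Wx; apply: AB; exists x; split=> //; exact: WB.
have /choice[V VP] : forall z, exists V,
    [/\ open V, C z -> V z & closure V `<=` U z].
  move=> z; have [Cz|nCz] := pselect (C z); last first.
    by exists set0; split=> //; [exact: open0|rewrite closure0].
  have [oU /(_ Cz) Uz _] := UP z.
  have [W Wz WU] := regX z (U z) (open_nbhs_nbhs (conj oU Uz)).
  exists W°; split; [exact: open_interior|by []|].
  by apply: subset_trans WU; apply: closureS; exact: interior_subset.
exists U, V; split; try by move=> z; have [] := VP z.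
move=> S cS; have [S0|/set0P Sn0] := eqVneq S set0.
  have [y Cy] := filter_ex FC; exists y; split=> //.
  by move=> z; rewrite S0.
have [s Ss] := countable_range cS Sn0.
apply: contrapT => /forallNP nS.
have FP n : F [set y | C y /\ forall k, (k < n)%N -> ~ U (s k) y].
  elim: n => [|n IH]; first by apply: filterS FC.
  have [_ _ FU] := UP (s n); apply: filterS (filterI IH FU).
  move=> y [[Cy Hy] Uy]; split=> // k; rewrite ltnS leq_eqVlt.
  by move=> /orP[/eqP->//|]; exact: Hy.
have /choice[d dP] : forall n, exists y,
    C y /\ forall k, (k < n)%N -> ~ U (s k) y.
  by move=> n; exact: filter_ex (FP n).
have [z Cz dz] := ccC d (fun n => proj1 (dP n)).
apply: (nS z); split=> // w; rewrite Ss => -[k _ <-] Uz.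
have [oU _ _] := UP (s k); have [m km Udm] := dz _ oU Uz k.+1.
by have [_ /(_ k km)] := dP m.
Qed.

Theorem MA_countably_compact_compact C : MartinsAxiom -> notCH ->
  regular_space X -> open_Fsigma -> closed C -> countably_compact C ->
  compact C.
Proof.
move=> MA nCH regX Fs clC ccC; apply: contrapT => ncC.
have [U0 [V0 [oV0 V0z V0U0 U0c]]] := not_compact_cover regX ccC ncC.
have [I [lt [wf tri clt ncI cI]]] := notCH_omega1_like nCH.
(* A right-separated sequence: no [x a] lies in the neighbourhood [U0 (x b)] of an earlier [x b]. *)
have [x xP] := wf_countable_choice wf clt U0c.
pose U a := U0 (x a); pose V a := V0 (x a).
have VU a : closure (V a) `<=` U a by exact: V0U0.
have VU' a : V a `<=` U a by apply: subset_trans (VU a); exact: subset_closure.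
have oV a : open (V a) by exact: oV0.
have [K clK OK] := Fs _ (bigcup_open (fun j (_ : setT j) => oV j)).
have [n ncn] : exists n, ~ countable [set a | K n (x a)].
  apply: contrapT => /forallNP h; apply: ncI.
  have -> : [set: I] = \bigcup_n [set a | K n (x a)].
    rewrite predeqE => a; split=> // _.
    have : (\bigcup_a V a) (x a) by exists a => //; apply: V0z; case: (xP a).
    by rewrite OK => -[n _ ?]; exists n.
  apply: bigcup_countable => // n _; apply: contrapT; exact: h.
(* [E] lies in the union of the [V a], since [K n] does, yet contains uncountably many [x a], so
   countably many [U a] cannot cover it. *)
pose E := K n `&` C.
have clE : closed E by exact: closedI.
have ccE : countably_compact E.
  move=> d dE; have [z Cz dz] := ccC d (fun n => proj2 (dE n)).
  by exists z => //; exact: seq_cluster_closed dz.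
have EV y : E y -> exists a, V a y.
  move=> [Ky _]; have : (\bigcup_n K n) y by exists n.
  by rewrite -OK => -[a _ ?]; exists a.
have EU (T : set I) : countable T -> exists y, E y /\ forall a, T a -> ~ U a y.
  (* The indices at or below some member of [T] form a countable set, so some [x b] in [K n] comes
     after all of [T]. *)
  move=> cT; have cT' : countable (\bigcup_(a in T) (a |` [set b | lt b a])).
    apply: bigcup_countable => // a _.
    by apply: countable_setU; [exact: countable1|exact: clt].
  have [b [Kb nb]] : exists b, K n (x b) /\
      ~ (\bigcup_(a in T) (a |` [set b | lt b a])) b.
    apply: contrapT => /forallNP h; apply: ncn; apply: sub_countable cT'.
    by apply: subset_card_le => b Kb; apply: contrapT => nb; case: (h b).
  have [Cb Hb] := xP b; exists (x b); split=> // a Ta Uab.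
  have [ab|ab|ab] := tri a b.
  - by apply: nb; exists a => //; left.
  - by apply: (Hb (x a)) => //; exists a.
  - by apply: nb; exists a => //; right.
have [[D [cD DE Dun]]|nD] := pselect (exists D, [/\ countable D, D `<=` E &
    forall T : set I, countable T ->
      exists2 y, closure D y & forall a, T a -> ~ closure (V a) y]).
  have [d Dd] : exists d : nat -> X, D = range d.
    apply: countable_range => //; have [y Dy _] := Dun set0 (countable0 _).
    by apply/set0P/eqP => D0; move: Dy; rewrite D0 closure0.
  have dE k : E (d k) by apply: DE; rewrite Dd; exists k.
  have [||A [infA HA]] := @MA_pseudo_intersection I
      (fun a => [set k | ~ closure (V a) (d k)]) MA cI.
  - by move/finite_set_countable.
  - move=> t fin.
    (* If only finitely many [d k] avoided the closures for [a] in [t], one further [V (c k)] for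
       each of them would give a finite family whose closures contain every [d k], hence
       [closure D], against [Dun]. *)
    have /choice[c cP] : forall k, exists a, V a (d k).
      by move=> k; exact: EV.
    pose T := [set` t] `|` c @` [set k | forall a, a \in t ->
      ~ closure (V a) (d k)].
    have finT : finite_set T.
      by rewrite finite_setU; split; [exact: finite_fset|exact: finite_image].
    have [|y Dy Hy] := Dun T; first exact: finite_set_countable.
    pose N := ~` \bigcup_(a in T) closure (V a).
    have oN : open N.
      apply: closed_openC; apply: (closed_bigcup finT) => a _.
      exact: closed_closure.
    have [|w [+ Nk]] := Dy N.
      by apply: open_nbhs_nbhs; split=> // -[a Ta]; exact: Hy.
    rewrite Dd => -[k _ dk]; rewrite -dk in Nk; apply: (Nk).
    exists (c k); last exact/subset_closure/cP.
    by right; exists k => //= a ta ca; apply: Nk; exists a => //; left.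
  have [e einj eA] := infinite_set_inj infA.
  (* [z] lies in some [V a], but only finitely many indices [k] in [A] have [d k] in the closure of
     [V a]. *)
  have [z Ez dz] := ccE (d \o e) (fun k => dE _).
  have [a Vaz] := EV z Ez.
  have [|N HN] := @finite_set_nat_bound
      (e @^-1` (A `\` [set k | ~ closure (V a) (d k)])).
    by apply: finite_preimage => // m m' _ _; exact: einj.
  have [m Nm Vm] := dz _ (oV a) Vaz N.
  have /HN : (e @^-1` (A `\` [set k | ~ closure (V a) (d k)])) m.
    by split=> //=; apply; exact: subset_closure.
  by rewrite ltnNge Nm.
have /choice[T TP] : forall D, exists T : set I, countable D -> D `<=` E ->
    countable T /\ forall y, closure D y -> exists2 a, T a & closure (V a) y.
  move=> D; have [[cD DE]|nh] := pselect (countable D /\ D `<=` E); last first.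
    by exists set0 => cD DE; case: nh.
  apply: contrapT => /forallNP h; apply: nD; exists D; split=> // T cT.
  apply: contrapT => hT; apply: (h T) => _ _; split=> // y Dy.
  apply: contrapT => hy; apply: hT; exists y => // a Ta ca.
  by apply: hy; exists a.
have [i0 _] : [set: I] !=set0.
  by apply/set0P/eqP => I0; apply: ncI; rewrite I0.
have /choice[c cP] : forall y, exists a, E y -> V a y.
  move=> y; have [/EV[a]|] := pselect (E y); first by exists a.
  by exists i0.
have TP' S : countable S -> countable (T (S `&` E)) /\
    forall y, closure (S `&` E) y -> exists2 a, T (S `&` E) a & closure (V a) y.
  move=> cS; apply: TP; last by move=> ? [].
  by apply: sub_countable cS; apply: subset_card_le; move=> ? [].
(* The condition on [T] keeps each new point outside the closure of the earlier ones, the condition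
   on [c] outside their chosen neighbourhoods; together they make the sequence discrete. *)
have [|y yP] := @wf_countable_choice I X lt (fun S y => [/\ E y,
    forall a, T (S `&` E) a -> ~ U a y & forall s, S s -> ~ U (c s) y])
    wf clt.
  move=> S cS; have [cT _] := TP' S cS.
  have [|y [Ey Hy]] := EU (T (S `&` E) `|` c @` S).
    apply: countable_setU => //; apply: sub_countable cS; exact: card_image_le.
  exists y; split=> // a Ta; apply: Hy; [by left|by right; exists a].
have yE a : E (y a) by case: (yP a).
pose S a := y @` [set b | lt b a].
apply: ncI; apply: (@discrete_countable E I y
  (fun a => V (c (y a)) `&` ~` closure (S a `&` E)) Fs ccE yE) => [a|a|a b].
- by apply: openI => //; exact/closed_openC/closed_closure.
- split; first exact: cP.
  have [_ Ta _] := yP a.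
  have [|_ /(_ (y a)) h] := TP' (S a).
    by apply: sub_countable (clt a); exact: card_image_le.
  by move=> /h[b /Ta nU /VU].
- move=> [Vb nSb]; have [//|ab|ba] := tri a b.
    have [_ _ /(_ (y a)) nU] := yP b; case: nU; first by exists a.
    exact: VU'.
  by case: nSb; apply: subset_closure; split=> //; exists b.
Qed.

End countably_compact.

(** * Adding a point along a filter *)

Lemma setI_eq_iff (T : Type) (S A B : set T) (x : T) :
  A `&` S = B `&` S -> S x -> A x <-> B x.
Proof.
move=> AB Sx; have : (A `&` S) x = (B `&` S) x by rewrite AB.
by rewrite propeqE => -[h1 h2]; split=> h; [case: h1|case: h2].
Qed.

(** * Normality relative to a subset *)

Section normal_in.
Variables (R : realType) (T : topologicalType).

(** Normality of the subspace [S], told through open and closed sets of the whole space, so that one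
    argument carries both normality and hereditary normality to the extension. *)
Definition normal_in (S : set T) := forall P Q : set T, closed P -> closed Q ->
  (forall x, S x -> P x -> Q x -> False) ->
  exists U V : set T, [/\ open U, open V, forall x, S x -> P x -> U x,
    forall x, S x -> Q x -> V x & forall x, S x -> U x -> V x -> False].

Lemma normal_inT : normal_space T <-> normal_in setT.
Proof.
rewrite (@normal_openP R); split=> nT P Q cP cQ PQ.
  have [|U [V [oU oV PU QV UV]]] := nT P Q cP cQ.
    by rewrite -subset0 => x [] /PQ; apply.
  exists U, V; split=> // [x _ /PU|x _ /QV|x _ Ux Vx] //.
  have : (U `&` V) x by [].
  by rewrite UV.
have [|U [V [oU oV PU QV UV]]] := nT P Q cP cQ.
  by move=> x _ Px Qx; have : (P `&` Q) x by []; rewrite PQ.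
exists U, V; split=> // [x /PU|x /QV|]; [exact|exact|].
by rewrite -subset0 => x [] /UV; apply.
Qed.

Lemma normal_subspaceP (S : set T) : normal_space (subspace S) <-> normal_in S.
Proof.
rewrite (@normal_openP R); split=> nS P Q.
  move=> cP cQ PQ.
  have cI (A : set T) : closed A -> closed (A `&` S : set (subspace S)).
    move=> cA; apply: closedI; last exact: closed_subspaceT.
    exact: closed_subspaceW.
  have [|U [V [/open_subspaceP[U' oU' UU']
    /open_subspaceP[V' oV' VV'] PU QV UV]]]
      := nS _ _ (cI _ cP) (cI _ cQ).
    by rewrite -subset0 => x [[Px Sx] [Qx _]]; exact: (PQ x).
  have UE x : S x -> U' x <-> U x by exact: setI_eq_iff.
  have VE x : S x -> V' x <-> V x by exact: setI_eq_iff.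
  exists U', V'; split=> // [x Sx Px|x Sx Qx|x Sx].
  - by apply/UE => //; apply: PU.
  - by apply/VE => //; apply: QV.
  - move=> /(UE _ Sx) Ux /(VE _ Sx) Vx; have : (U `&` V) x by [].
    by rewrite UV.
move=> /closed_subspaceP[P' cP' PP'] /closed_subspaceP[Q' cQ' QQ'] PQ.
have PE x : S x -> P' x <-> P x by exact: setI_eq_iff.
have QE x : S x -> Q' x <-> Q x by exact: setI_eq_iff.
have PQ0 x : P x -> Q x -> False.
  by move=> Px Qx; have : (P `&` Q) x by []; rewrite PQ.
have [|U [V [oU oV PU QV UV]]] := nS P' Q' cP' cQ'.
  by move=> x Sx /(PE x Sx) + /(QE x Sx); exact: PQ0.
have oI (A B : set T) : open A ->
    open ((A `&` S) `|` (B `\` S) : set (subspace S)).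
  move=> oA; apply: openU; last by apply: open_subspace_out => x [].
  by apply: openI; [exact: open_subspaceW|exact: open_subspaceT].
(* Points outside [S] are isolated in [subspace S], so the parts of [P] and [Q] lying there can
   simply be adjoined. *)
exists ((U `&` S) `|` (P `\` S)), ((V `&` S) `|` (Q `\` S)); split.
- exact: oI.
- exact: oI.
- move=> x Px; have [Sx|nSx] := pselect (S x); [left|by right].
  by split=> //; apply: PU => //; apply/PE.
- move=> x Qx; have [Sx|nSx] := pselect (S x); [left|by right].
  by split=> //; apply: QV => //; apply/QE.
- rewrite -subset0 => x [[[Ux Sx]|[Px nSx]] [[Vx Sx']|[Qx nSx']]] //.
  + exact: (UV x).
  + exact: (PQ0 x).
Qed.

End normal_in.

Section extension.
Local Open Scope ring_scope.
Context {R : realType} {X : topologicalType} {G : set_system X}.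
Context {FG : ProperFilter G}.
Implicit Types (f : X -> R) (U V : set X).

Definition vanishing f := continuous f /\ f x @[x --> G] --> (0 : R).

(* The traces on [X] of the neighbourhoods of the added point. *)
Definition vanishing_nbhs V :=
  exists2 f, vanishing f & forall x, `|f x| < 1 -> V x.

Lemma vanishing_norm f : vanishing f -> vanishing (fun x => `|f x|).
Proof.
move=> [cf f0]; split; first by move=> x; apply: cvg_norm; exact: cf.
have h := cvg_norm f0; rewrite normr0 in h; exact: h.
Qed.

Lemma vanishingD f g :
  vanishing f -> vanishing g -> vanishing (fun x => f x + g x).
Proof.
move=> [cf f0] [cg g0]; split.
  by move=> x; apply: cvgD; [exact: cf|exact: cg].
have h := cvgD f0 g0; rewrite addr0 in h; exact: h.
Qed.

Lemma vanishingZ (c : R) f : vanishing f -> vanishing (fun x => c * f x).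
Proof.
move=> [cf f0]; split.
  by move=> x; apply: cvgM; [exact: cvg_cst|exact: cf].
have h := cvgM (cvg_cst c) f0; rewrite mulr0 in h; exact: h.
Qed.

Lemma vanishing_nbhsI : setI_closed vanishing_nbhs.
Proof.
move=> A B [f vf fA] [g vg gB]; exists (fun x => `|f x| + `|g x|).
  by apply: vanishingD; exact: vanishing_norm.
move=> x; have fx := normr_ge0 (f x); have gx := normr_ge0 (g x).
by rewrite ger0_norm ?addr_ge0 // => fg; split; [apply: fA|apply: gB]; lra.
Qed.

Lemma vanishing_nbhsS U V : U `<=` V -> vanishing_nbhs U -> vanishing_nbhs V.
Proof. by move=> UV [f vf fU]; exists f => // x /fU; exact: UV. Qed.

Lemma vanishing_nbhs_lt f (r : R) : vanishing f -> 0 < r ->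
  vanishing_nbhs [set x | `|f x| < r].
Proof.
move=> vf r0; exists (fun x => r^-1 * f x); first exact: vanishingZ.
move=> x /=; rewrite normrM ger0_norm ?invr_ge0 ?ltW //.
by rewrite mulrC ltr_pdivrMr // mul1r.
Qed.

Lemma vanishing_nbhs_filter V : vanishing_nbhs V -> G V.
Proof.
move=> [f [_ f0] fV]; apply: filterS fV _.
exact: ((cvgr0Pnorm_lt f).1 f0 1 ltr01).
Qed.

(** The vacuous [let]s keep the filter and [R] as parameters of the type, since its topology depends
    on them. *)
Definition extension : Type := let _ := FG in let _ := R in option X.

HB.instance Definition _ := Choice.copy extension (option X).

Let op : set_system extension := [set O | open (Some @^-1` O : set X) /\
  (O None -> vanishing_nbhs (Some @^-1` O : set X))].

Let opT : op setT.
Proof.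
split; first exact: openT; move=> _; exists (cst 0) => //; split.
  by move=> x; exact: cvg_cst.
exact: cvg_cst.
Qed.

Let opI : setI_closed op.
Proof.
move=> A B [oA nA] [oB nB]; split; first exact: openI.
by move=> [/nA NA /nB NB]; exact: vanishing_nbhsI.
Qed.

Let op_bigU (I : Type) (f : I -> set extension) :
  (forall i, op (f i)) -> op (\bigcup_i f i).
Proof.
move=> opf; split.
  have -> : Some @^-1` (\bigcup_i f i) = \bigcup_i (Some @^-1` (f i) : set X).
    by [].
  by apply: bigcup_open => i _; case: (opf i).
move=> [i _ fi]; have [_ /(_ fi)] := opf i.
by apply: vanishing_nbhsS => x fx; exists i.
Qed.

HB.instance Definition _ := isOpenTopological.Build extension opT opI op_bigU.

Lemma extension_openE (O : set extension) : open O <->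
  open (Some @^-1` O : set X) /\ (O None -> vanishing_nbhs (Some @^-1` O)).
Proof. by []. Qed.

Definition ext_base U : set extension :=
  [set y : option X | if y is Some x then U x else False].

Definition ext_cone U : set extension :=
  [set y : option X | if y is Some x then U x else True].

Lemma open_ext_base U : open U -> open (ext_base U).
Proof. by move=> oU; apply/extension_openE. Qed.

Lemma open_ext_cone U : open U -> vanishing_nbhs U -> open (ext_cone U).
Proof. by move=> oU nU; apply/extension_openE. Qed.

Lemma open_norm_lt f (r : R) : continuous f -> open [set x | `|f x| < r].
Proof.
move=> cf; apply: (@open_comp _ _ (fun x => `|f x|) [set y | y < r]).
  by move=> x _; apply: cvg_norm; exact: cf.
exact: open_lt.
Qed.

Lemma open_norm_gt f (r : R) : continuous f -> open [set x | r < `|f x|].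
Proof.
move=> cf; apply: (@open_comp _ _ (fun x => `|f x|) [set y | r < y]).
  by move=> x _; apply: cvg_norm; exact: cf.
exact: open_gt.
Qed.

Lemma extension_embedding : embedding (Some : X -> extension).
Proof.
split; first by move=> x y [].
  by apply/continuousP => O /extension_openE[].
move=> U oU; exists (ext_base U); first exact: open_ext_base.
rewrite predeqE => y; split=> [[x Ux <-]|[+ [x _ xy]]].
  by split=> //; exists x.
by rewrite -xy => Ux; exists x.
Qed.

Lemma extension_dense : dense (range (Some : X -> extension)).
Proof.
move=> O [[x Ox|ON]] /extension_openE[oO nO].
  by exists (Some x); split=> //; exists x.
have [x Ox] := filter_ex (vanishing_nbhs_filter (nO ON)).
by exists (Some x); split=> //; exists x.
Qed.

Lemma extension_point :
  exists p : extension, ~` range (Some : X -> extension) = [set p].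
Proof.
exists (None : option X); rewrite predeqE => -[x|]; split=> //.
  by move=> []; exists x.
by move=> _ [].
Qed.

(** A nonempty clopen set [D] must contain [None]: otherwise its complement is a neighbourhood of
    [None], with trace in [G], which the clopen trace of [D] fails to meet. Two complementary sets
    cannot both contain [None]. *)
Lemma extension_connected :
  (forall U, clopen U -> U !=set0 -> forall V, G V -> U `&` V !=set0) ->
  connected [set: extension].
Proof.
move=> GU.
have noU (D : set extension) : open D -> closed D -> D !=set0 -> D None.
  move=> oD cD D0; apply: contrapT => DN.
  have /extension_openE[oD' _] := oD.
  have /extension_openE[oC /(_ DN) /vanishing_nbhs_filter GC] :=
    closed_openC cD.
  have [||x [Dx nDx]] := GU (Some @^-1` D) _ _ _ GC.
  - by split; [exact: oD'|rewrite -openC; exact: oC].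
  - by case: D0 => -[x Dx|//]; exists x.
  - exact: nDx.
move=> B B0 [C oC BC] [C' cC' BC']; rewrite setTI in BC; rewrite setTI in BC'.
have BN : B None by apply: noU => //; rewrite ?BC // -BC BC'.
rewrite predeqE => y; split=> // _; apply: contrapT => By.
have : (~` B) None; last exact.
apply: noU; [|by rewrite BC; exact: open_closedC|by exists y].
by rewrite BC'; exact: closed_openC.
Qed.

Hypothesis Gfree : forall x : X, exists2 W, open_nbhs x W & G (~` W).
Hypothesis crX : completely_regular_space X.

(** By [Gfree] some neighbourhood [W] of [x] has complement in [G]; a function that is zero outside
    [U] and [W] is then zero on a set of [G], hence vanishing. *)
Lemma vanishing_bump U x : open U -> U x -> exists f,
  [/\ vanishing f, forall y, 0 <= f y <= 1, f x = 1 &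
      forall y, ~ U y -> f y = 0].
Proof.
move=> oU Ux; have [W [oW Wx] GW] := Gfree x.
have /(@uniform_separatorP _ R)[f [cf f01 f0 f1]] :
    uniform_separator [set x] (~` (U `&` W)).
  apply: crX; first by apply: open_closedC; exact: openI.
  by apply.
have f1' y : ~ (U `&` W) y -> 1 - f y = 0.
  by move=> nUy; have -> : f y = 1; [apply: f1; exists y|rewrite subrr].
exists (fun y => 1 - f y); split.
- split; first by move=> y; apply: cvgB; [exact: cvg_cst|exact: cf].
  apply: cvg_near_cst; apply: filterS GW => y Wy; apply: f1' => -[_ //].
- move=> y; have /f01 /= : range f (f y) by exists y.
  by rewrite in_itv /= => /andP[? ?]; lra.
- by have -> : f x = 0; [apply: f0; exists x|rewrite subr0].
- by move=> y nUy; apply: f1' => -[].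
Qed.

Lemma extension_accessible : accessible_space X -> accessible_space extension.
Proof.
move=> T1 [x|] [y|] xy //.
- have [|A [oA xA yA]] := T1 x y; first by apply: contra_neq xy => ->.
  exists (ext_base A); split; first exact: open_ext_base.
    by rewrite inE; rewrite inE in xA.
  by rewrite inE; rewrite inE in yA.
- exists (ext_base setT); split; [exact/open_ext_base/openT| |]; rewrite inE //.
- have [f [vf _ fy _]] := @vanishing_bump setT y openT I.
  exists (ext_cone [set x | `|f x| < 1]); split; rewrite ?inE //.
    apply: open_ext_cone; first by apply: open_norm_lt; case: vf.
    exact: vanishing_nbhs_lt.
  by move=> /=; rewrite fy normr1 ltxx.
Qed.

Lemma extension_continuous (F : extension -> R) :
  vanishing (fun x => F (Some x) - F None) -> continuous F.
Proof.
move=> vF; have cF : continuous (fun x : X => F (Some x)).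
  have -> : (fun x => F (Some x)) = (fun x => (F (Some x) - F None) + F None).
    by apply: funext => x; rewrite subrK.
  by move=> x; apply: cvgD; [case: vF => + _; exact|exact: cvg_cst].
apply/continuousP => A oA; apply/extension_openE; split.
  by apply: (@open_comp _ _ (fun x => F (Some x)) A) => // x _; exact: cF.
move=> /= AN; have [e /= e0 eA] :=
  (nbhs_ballP _ _).1 (open_nbhs_nbhs (conj oA AN)).
apply: vanishing_nbhsS (vanishing_nbhs_lt vF e0) => x /= xe.
by apply: eA; rewrite /ball /= distrC.
Qed.

Lemma extension_completely_regular : completely_regular_space extension.
Proof.
move=> a B cB nBa; apply/(@uniform_separatorP _ R).
have /extension_openE[oU nU] := closed_openC cB.
case: a nBa => [x|] nBa.
  have [f [vf f01 fx f0]] := vanishing_bump oU nBa.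
  exists (fun y : option X => if y is Some x then 1 - f x else 1); split.
  - apply: extension_continuous.
    have -> : (fun x => 1 - f x - 1) = (fun x => (-1) * f x).
      by apply: funext => z; lra.
    exact: vanishingZ.
  - move=> _ [[y|] _ <-] /=; rewrite in_itv /=; last by rewrite ler01 lexx.
    by have /andP[? ?] := f01 y; lra.
  - by move=> _ [_ -> <-] /=; rewrite fx subrr.
  - move=> _ [[y|] By <-] //=; rewrite f0 ?subr0 //.
have [f vf fU] := nU nBa.
(* [f] witnesses that the complement of [B] is a neighbourhood of [None], so [|f|] is at least 1 on
   [B]; truncation at 1 brings the values into the unit interval. *)
exists (fun y : option X =>
  if y is Some x then Order.min `|f x| 1 else 0); split.
- apply: extension_continuous; have [cf f0] := vanishing_norm vf.
  have -> : (fun x => Order.min `|f x| 1 - 0) = (fun x => Order.min `|f x| 1).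
    by apply: funext => x; rewrite subr0.
  split; first by move=> x; apply: (@continuous_min R X _ (cst 1));
    [exact: cf|exact: cvg_cst].
  apply/cvgr0Pnorm_lt => e e0.
  apply: filterS ((cvgr0Pnorm_lt _).1 f0 e e0) => x; rewrite normr_id => xe.
  by rewrite ger0_norm ?le_min ?normr_ge0 ?ler01 // gt_min xe.
- move=> _ [[y|] _ <-] /=; rewrite in_itv /=; last by rewrite ler01 lexx.
  by rewrite le_min normr_ge0 ler01 ge_min lexx orbT.
- by move=> _ [_ -> <-].
- move=> _ [[y|] By <-] //=; apply/min_idPr; rewrite leNgt; apply/negP => /fU.
  exact.
Qed.

Section normal_in_extension.
Variable S : set extension.
Hypothesis nS : normal_in (Some @^-1` S : set X).

(** Take [f] vanishing with [|f|] at least 1 on [Q] and split at level 1/2: adding [|f| < 1/2] to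
    [U] makes it a neighbourhood of [None], while [V] is cut down to [|f| > 1/2]. *)
Let separated_off_None (P Q : set extension) : closed P -> closed Q ->
  (forall y, S y -> P y -> Q y -> False) -> ~ Q None ->
  exists U V : set extension, [/\ open U, open V, forall y, S y -> P y -> U y,
    forall y, S y -> Q y -> V y & forall y, S y -> U y -> V y -> False].
Proof.
move=> cP cQ PQ QN.
have cSome (A : set extension) : closed A -> closed (Some @^-1` A : set X).
  by rewrite -!openC => /extension_openE[].
have [|U [V [oU oV PU QV UV]]] := nS (cSome _ cP) (cSome _ cQ).
  by move=> x; exact: PQ.
have /extension_openE[_ /(_ QN)[f vf fQ]] := closed_openC cQ.
have cf : continuous f by case: vf.
exists (ext_cone (U `|` [set x | `|f x| < 2^-1])),
  (ext_base (V `&` [set x | 2^-1 < `|f x|])); split.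
- apply: open_ext_cone; first by apply: openU => //; exact: open_norm_lt.
  apply: (@vanishing_nbhsS [set x | `|f x| < 2^-1]) => [x|]; first by right.
  by apply: vanishing_nbhs_lt => //; rewrite invr_gt0 ltr0n.
- by apply: open_ext_base; apply: openI => //; exact: open_norm_gt.
- by move=> [x|] // Sx Px; left; exact: PU.
- move=> [x|] Sx Qx; last by [].
  split; first exact: QV.
  rewrite /= ltNge; apply/negP => xle; apply: (fQ x) => //.
  by apply: le_lt_trans xle _; rewrite invf_lt1 ?ltr0n // ltr1n.
- move=> [x|] // Sx [Ux|/= xlt] [Vx xgt]; first exact: (UV x).
  by have := lt_trans xlt xgt; rewrite ltxx.
Qed.

Lemma extension_normal_in : normal_in S.
Proof.
move=> P Q cP cQ PQ; have [QN|] := pselect (Q None); last first.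
  exact: separated_off_None.
have [PN|] := pselect (P None); last first.
  move=> nP; have [|U [V [oU oV PU QV UV]]] := separated_off_None cQ cP _ nP.
    by move=> y Sy Qy Py; exact: (PQ y).
  by exists V, U; split=> // y Sy Vy Uy; exact: (UV y).
(* Both sets contain [None], so [S] does not, and separating the traces in [X] is enough. *)
have SN : ~ S None by move=> SN; exact: (PQ None).
have cSome (A : set extension) : closed A -> closed (Some @^-1` A : set X).
  by rewrite -!openC => /extension_openE[].
have [|U [V [oU oV PU QV UV]]] := nS (cSome _ cP) (cSome _ cQ).
  by move=> x; exact: PQ.
exists (ext_base U), (ext_base V); split; try exact: open_ext_base.
- by move=> [x|] //; exact: PU.
- by move=> [x|] //; exact: QV.
- by move=> [x|] //; exact: UV.
Qed.

End normal_in_extension.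

(** Since [f] is nowhere zero, the sets where [|f| < 1/(m+1)] have empty intersection in [X]. Adding
    them to the open sets [F k] gives neighbourhoods of [None] without enlarging the intersection in
    [X]. *)
Lemma extension_Gdelta f : vanishing f -> (forall x, f x != 0) ->
  (forall A : set X, closed A -> Gdelta A) ->
  forall A : set extension, closed A -> Gdelta A.
Proof.
move=> vf f0 GX A cA.
have [F [oF AF]] : Gdelta (Some @^-1` A : set X).
  by apply: GX; move: cA; rewrite -!openC => /extension_openE[].
have AP x : A (Some x) <-> forall n, F n x.
  have : (Some @^-1` A : set X) x = (\bigcap_n F n) x by rewrite AF.
  move=> /= ->; split=> [h n|h n _]; [exact: h|exact: h].
have cf : continuous f by case: vf.
have [AN|nAN] := pselect (A None); last first.
  exists (fun n => ext_base (F n)); split=> [n|]; first exact: open_ext_base.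
  rewrite predeqE => -[x|]; split=> //.
  - by move=> /AP h n _; exact: h.
  - by move=> h; apply/AP => n; exact: h.
  - by move=> /(_ 0%N I).
pose W (m : nat) := [set x | `|f x| < m.+1%:R^-1].
(* The doubly indexed family is listed through a coding of pairs [(k, m)]; numbers that code nothing
   contribute [setT]. *)
exists (fun n => if choice.unpickle n is Some (k, m) then ext_cone (F k `|` W m)
  else setT); split.
  move=> n; case: choice.unpickle => [[k m]|]; last exact: openT.
  apply: open_ext_cone; first by apply: openU => //; exact: open_norm_lt.
  apply: (@vanishing_nbhsS (W m)) => [x|]; first by right.
  by apply: vanishing_nbhs_lt => //; rewrite invr_gt0 ltr0n.
rewrite predeqE => -[x|]; split=> //.
- by move=> /AP h n _; case: choice.unpickle => [[k m]|//]; left; exact: h.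
- move=> h; apply/AP => k.
  have fx : 0 < `|f x| by rewrite normr_gt0.
  have [m] := ltr_add_invr fx; rewrite add0r => mx.
  have := h (choice.pickle (k, m)) I; rewrite choice.pickleK => -[//|/= Wx].
  by have := lt_trans Wx mx; rewrite ltxx.
- by move=> _ n _; case: choice.unpickle => [[k m]|].
Qed.

End extension.
Arguments extension R {X} G {FG}.

(** * Connectifications *)

Local Notation RR := (Rdefinitions.R : realType).

Lemma hereditarily_normal (X : topologicalType) :
  (forall A : set X, normal_space (subspace A)) -> normal_space X.
Proof.
by move=> /(_ setT)/(@normal_subspaceP RR); rewrite -(@normal_inT RR).
Qed.

Lemma Ti_completely_regular i (X : topologicalType) : Ti_space i X ->
  completely_regular_space X /\ accessible_space X.
Proof.
case: i => /= [//|[nX aX]|[nX aX]|[nX aX _]]; split=> //.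
- exact: (@normal_completely_regular RR).
- exact/(@normal_completely_regular RR)/aX/hereditarily_normal.
- exact: (@normal_completely_regular RR).
Qed.

Lemma regular_accessible_hausdorff (X : topologicalType) :
  regular_space X -> accessible_space X -> hausdorff_space X.
Proof.
move=> rX aX p q pq; apply: contrapT => npq.
have [U [V [oU oV Up qV UV]]] := (regular_openP p).1 (rX p) [set q]
  (accessible_closed_set1 aX (x := q)) npq.
have [x UVx] : U `&` V !=set0.
  apply: pq; apply: open_nbhs_nbhs; split=> //; exact: qV.
by rewrite UV in UVx.
Qed.

Lemma component_open (X : topologicalType) (x : X) :
  locally_connected_space X -> open (connected_component setT x).
Proof.
move=> lX; rewrite openE => y xy.
have [V [oV Vy cV _]] := lX y setT (filterT).
apply: filterS (open_nbhs_nbhs (conj oV Vy)) => z Vz.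
rewrite (same_connected_component xy).
exact: (connected_component_max Vy).
Qed.

Lemma clopen_component (X : topologicalType) (U : set X) (x : X) :
  clopen U -> U x -> connected_component setT x `<=` U.
Proof.
move=> [oU cU] Ux; have cC := @component_connected X setT x.
rewrite -[X in X `<=` _](_ : connected_component setT x `&` U = _).
  by move=> ? [].
apply: cC.
- by exists x; split=> //; exact: connected_component_refl.
- by exists U.
- by exists U.
Qed.

Lemma connectification_no_compact_component i (X : topologicalType) :
  locally_connected_space X -> has_Ti_one_point_connectification i X ->
  no_compact_component X.
Proof.
move=> lX [Y [e [[[einj ce eo] _ [p ep] cY] TY]]] x cC.
have [crY aY] := Ti_completely_regular TY.
have hY : hausdorff_space Y.
  exact: regular_accessible_hausdorff (@completely_regular_regular RR _ crY) aY.
have oe : open (range e).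
  by rewrite -closedC ep; exact: accessible_closed_set1.
have [V oV eV] := eo _ (component_open x lX).
have eC : e @` connected_component setT x = setT.
  apply: cY.
  - by exists (e x), x => //; exact: connected_component_refl.
  - exists (e @` connected_component setT x); rewrite ?setTI //.
    by rewrite eV; exact: openI.
  - exists (e @` connected_component setT x); rewrite ?setTI //.
    apply: compact_closed => //; apply: continuous_compact => //.
    exact: continuous_subspaceT.
have : (~` range e) p by rewrite ep.
apply; have [y _ yp] : (e @` connected_component setT x) p by rewrite eC.
by exists y.
Qed.

(** A nonempty clopen set contains the component of each of its points, so it meets every member of
    [G] once components do, as connectedness requires. *)
Lemma extension_connectification i (X : topologicalType) (G : set_system X)
    (FG : ProperFilter G) :
  (forall x : X, exists2 W, open_nbhs x W & G (~` W)) ->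
  (forall x V, G V -> connected_component setT x `&` V !=set0) ->
  Ti_space i X ->
  (i = T6 ->
    exists2 f : X -> RR, vanishing (G := G) f & forall x, f x != 0%R) ->
  has_Ti_one_point_connectification i X.
Proof.
move=> Gfree GC TX f6; have [crX aX] := Ti_completely_regular TX.
exists (extension RR G), (Some : X -> extension RR G); split.
  split; [exact: extension_embedding|exact: extension_dense|
    exact: extension_point|].
  apply: extension_connected => U clU [x Ux] V GV.
  have [y [Cy Vy]] := GC x V GV; exists y; split=> //.
  exact: (clopen_component clU Ux).
have aY : accessible_space (extension RR G) by exact: extension_accessible.
have nT : normal_space X -> normal_space (extension RR G).
  move=> /(@normal_inT RR) nX; apply/(@normal_inT RR).
  exact: extension_normal_in.
case: i TX f6 => /= [_ _|[nX _] _|[nX _] _|[nX _ GdX] /(_ erefl)[f vf f0]];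
  split=> //.
- exact: extension_completely_regular.
- exact: nT.
- move=> A; apply/(@normal_subspaceP RR); apply: extension_normal_in.
  exact/(@normal_subspaceP RR)/nX.
- exact: nT.
- exact: extension_Gdelta vf f0 GdX.
Qed.

(** * Gluing over the components *)

Section components.
Variable X : topologicalType.
Hypothesis lX : locally_connected_space X.
Local Notation C x := (connected_component [set: X] x).

Let CC (x y : X) : C x y -> C y = C x.
Proof. by move=> /same_connected_component. Qed.

Lemma noncompact_connectification i : i <> T6 -> (exists x : X, True) ->
  Ti_space i X -> no_compact_component X ->
  has_Ti_one_point_connectification i X.
Proof.
move=> i6 [x0 _] TX nC.
(* The filter is chosen for the component as a set, so that all points of a component share it;
   other sets get a junk value. *)
have /choice[F FP] : forall D : set X, exists F : set_system X,
    (exists x, D = C x) -> [/\ ProperFilter F, F D & D `&` cluster F = set0].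
  move=> D; have [[x ->]|nD] := pselect (exists x, D = C x); last first.
    by exists setT => /nD.
  have /existsNP[F /not_implyP[PF /not_implyP[FD /set0P/negP]]] := nC x.
  by rewrite negbK => /eqP FC; exists F.
pose FX x := F (C x).
have FXP x :
    [/\ ProperFilter (FX x), FX x (C x) & C x `&` cluster (FX x) = set0].
  by apply: FP; exists x.
pose G : set_system X := [set V | forall x, FX x V].
have GF : ProperFilter G.
  split.
    by move=> /(_ x0); have [PF _ _] := FXP x0; exact: filter_not_empty.
  split=> [x|A B GA GB x|A B AB GA x]; have [PF _ _] := FXP x.
  - exact: filterT.
  - by apply: filterI; [exact: GA|exact: GB].
  - by apply: filterS AB _; exact: GA.
apply: (@extension_connectification i X G GF) => //.
- move=> z; have [PF FC FC0] := FXP z.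
  have Czz : C z z by exact: connected_component_refl.
  have /existsNP[A /existsNP[B]] : ~ cluster (FX z) z.
    by move=> Fz; have : (C z `&` cluster (FX z)) z by []; rewrite FC0.
  move=> /not_implyP[FA /not_implyP[+ AB]]; rewrite nbhsE => -[W [oW Wz] WB].
  (* Along the filter of [C z] the complement of [W] is large by the choice of [W]; along that of
     another component, because it is disjoint from [C z]. *)
  exists (W `&` C z).
    by split=> //; apply: openI => //; exact: component_open.
  move=> x; have [PFx FCx _] := FXP x.
  have [zx|nzx] := pselect (C z x).
    rewrite /FX (CC zx); apply: filterS FA => y Ay [Wy _]; apply: AB.
    by exists y; split=> //; exact: WB.
  apply: filterS FCx => y Cxy [_ Czy]; apply: nzx.
  by rewrite -(CC Czy) (CC Cxy); exact: connected_component_refl.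
- move=> x V GV; have [PF FC _] := FXP x.
  by have [y [Cy Vy]] := filter_ex (filterI FC (GV x)); exists y.
Qed.

Local Open Scope ring_scope.

Lemma positive_connectification (f : set X -> X -> RR) : (exists x : X, True) ->
  Ti_space T6 X -> (forall x, [/\ continuous (f (C x)),
    forall y, C x y -> 0 < f (C x) y &
    forall e, 0 < e -> exists2 y, C x y & f (C x) y < e]) ->
  has_Ti_one_point_connectification T6 X.
Proof.
move=> [x0 _] TX fP; pose g y := f (C y) y.
have gE x y : C x y -> g y = f (C x) y by rewrite /g => /CC ->.
have Cxx x : C x x by exact: connected_component_refl.
have g0 y : 0 < g y by have [_ fp _] := fP y; exact: fp.
have ginf x e : 0 < e -> exists2 y, C x y & g y < e.
  by have [_ _ fi] := fP x; move=> /fi[y Cy ye]; exists y; rewrite ?(gE x).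
have cg : continuous g.
  move=> x; have [cf _ _] := fP x; rewrite /continuous_at.
  rewrite (gE x x (Cxx x)); apply: cvg_trans (cf x).
  apply: near_eq_cvg; have : nbhs x (C x).
    by apply: open_nbhs_nbhs; split=> //; exact: component_open.
  by apply: filterS => y Cy; rewrite (gE x).
pose G : set_system X := [set V | forall x,
  exists2 e, 0 < e & forall y, C x y -> g y < e -> V y].
have GF : ProperFilter G.
  split.
    move=> /(_ x0)[e e0 he]; have [y Cy ye] := ginf x0 e e0.
    exact: (he y).
  split=> [x|A B GA GB x|A B AB GA x].
  - by exists 1.
  - have [e e0 eA] := GA x; have [e' e'0 eB] := GB x.
    exists (Order.min e e'); first by rewrite lt_min e0.
    by move=> y Cy; rewrite lt_min => /andP[? ?]; split; [exact: eA|exact: eB].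
  - by have [e e0 eA] := GA x; exists e => // y Cy /(eA y Cy); exact: AB.
apply: (@extension_connectification T6 X G GF) => //.
- move=> z; exists [set y | g z / 2 < g y].
    split; last by rewrite /= ltr_pdivrMr // ltr_pMr // ltr1n.
    apply: (@open_comp _ _ g [set y | g z / 2 < y]); last exact: open_gt.
    by move=> y _; exact: cg.
  move=> x; exists (g z / 2); first by rewrite divr_gt0.
  by move=> y _ yz /= zy; have := lt_trans yz zy; rewrite ltxx.
- move=> x V /(_ x)[e e0 eV]; have [y Cy ye] := ginf x e e0.
  by exists y; split=> //; exact: eV.
- move=> _; exists g; last by move=> x; rewrite gt_eqF.
  split=> //; apply/cvgr0Pnorm_lt => e e0 x; exists e => // y _.
  by rewrite ger0_norm // (ltW (g0 y)).
Qed.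

End components.

Lemma Gdelta_open_Fsigma (X : topologicalType) :
  (forall A : set X, closed A -> Gdelta A) -> open_Fsigma X.
Proof.
move=> GX O oO; have [F [oF OF]] := GX _ (open_closedC oO).
exists (fun n => ~` F n); first by move=> n; exact: open_closedC.
by rewrite -setC_bigcap -OF setCK.
Qed.

(* A sequence without cluster point takes each value finitely often and its
   range is closed and discrete, so [1/(k+1)] on the [k]-th term extends to
   [X] by Tietze; adding a Urysohn function makes the extension positive. *)
Lemma positive_inf0_function (X : topologicalType) (D : set X) :
  normal_space X -> accessible_space X -> closed D -> ~ countably_compact D ->
  exists f : X -> RR, [/\ continuous f, forall y, (0 < f y)%R &
    forall e, (0 < e)%R -> exists2 y, D y & (f y < e)%R].
Proof.
move=> nX aX clD /existsNP[d /not_implyP[dD nd]].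
have locfin z :
    exists U N, [/\ open U, U z & forall m, (N <= m)%N -> ~ U (d m)].
  have [Dz|nDz] := pselect (D z); last first.
    exists (~` D), 0%N; split=> //; first exact: closed_openC.
    by move=> m _; apply; exact: dD.
  apply: contrapT => h; apply: nd; exists z => // U oU Uz n.
  apply: contrapT => h'; apply: h; exists U, n; split=> // m nm Um.
  by apply: h'; exists m.
pose A := range d.
have clS (B : set X) : B `<=` A -> closed B.
  move=> BA z clBz; apply: contrapT => nBz.
  have [U [N [oU Uz UN]]] := locfin z.
  pose Z := B `&` d @` `I_N.
  have clZ : closed Z.
    apply: (accessible_finite_set_closed.1 aX).
    by apply: finite_setIr; apply: finite_image; exact: finite_II.
  have [|y [By [Uy nZy]]] := clBz (U `&` ~` Z).
    apply: open_nbhs_nbhs; split; last by split=> // -[].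
    by apply: openI => //; exact: closed_openC.
  have [m _ my] := BA _ By; rewrite -my in Uy nZy By.
  have [mN|Nm] := ltnP m N; last exact: (UN m).
  by apply: nZy; split=> //; exists m.
have clA : closed A by exact: clS.
have /choice[k kP] : forall y, exists n, A y -> d n = y.
  by move=> y; have [[n _ <-]|nA] := pselect (A y); [exists n|exists 0%N].
pose g0 (y : X) : RR := ((k y).+1%:R^-1)%R.
have [||g [gE cg _]] :=
    @continuous_bounded_extension X RR nX A clA g0 1%R ltr01.
- apply/subspace_continuousP => x Ax.
  apply: cvg_near_cst; rewrite /within /=.
  have oW : open (~` (A `\` [set x])).
    by apply: closed_openC; apply: clS => ? [].
  apply: filterS (open_nbhs_nbhs (conj oW _)); last by move=> -[_]; apply.
  move=> y nAy Ay; congr g0; apply: contrapT => yx; exact: nAy.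
- move=> x _; rewrite ger0_norm ?invr_ge0 //.
  by rewrite invf_le1 ?ltr0n // ler1n.
have gA y : A y -> g y = g0 y by move=> Ay; rewrite gE // inE.
have clZ : closed (g @^-1` [set 0%R]).
  apply: (closed_comp (D := [set 0%R])) => [x _|]; [exact: cg|].
  exact: closed_eq.
have /(@uniform_separatorP _ RR)[h [ch h01 hA hZ]] :
    uniform_separator A (g @^-1` [set 0%R]).
  apply: (@normal_separatorP RR X).1 => //.
  rewrite -subset0 => y [Ay /=]; rewrite gA // /g0.
  by move/eqP; rewrite invr_eq0 pnatr_eq0.
have h0 y : (0 <= h y)%R.
  by have /h01 : range h (h y) by [exists y]; rewrite /= in_itv => /andP[].
exists (fun y => `|g y| + h y)%R; split.
- by move=> y; apply: cvgD; [apply: cvg_norm; exact: cg|exact: ch].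
- move=> y; have [gy0|gy0] := eqVneq (g y) 0%R.
    have -> : h y = 1%R by apply: hZ; exists y.
    by rewrite ltr_wpDl.
  by rewrite ltr_wpDr // normr_gt0.
- move=> e e0; have [n] := ltr_add_invr e0; rewrite add0r => ne.
  have /choice[M MP] : forall i, exists N, forall m, (N <= m)%N -> d m <> d i.
    move=> i; have [U [N [oU Uz UN]]] := locfin (d i).
    by exists N => m Nm dmi; apply: (UN m Nm); rewrite dmi.
  pose m := \max_(i < n.+1) M i; pose y := d m.
  have Ay : A y by exists m.
  exists y; first exact: dD.
  have -> : h y = 0%R by apply: hA; exists y.
  rewrite addr0 gA // ger0_norm ?invr_ge0 //.
  apply: le_lt_trans ne; rewrite lef_pV2 ?posrE ?ltr0n // ler_nat ltnS leqNgt.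
  apply/negP => kn.
  have kn' : (k y < n.+1)%N by exact: ltn_trans kn _.
  apply: (MP (k y) m); last by rewrite kP.
  exact: (leq_bigmax (Ordinal kn')).
Qed.

Theorem theorem2p3 (i : sep_index) (X : topologicalType) :
  (i <> T6 \/ (MartinsAxiom /\ notCH)) ->
  (exists x : X, True) ->
  locally_connected_space X -> Ti_space i X ->
  (has_Ti_one_point_connectification i X <-> no_compact_component X).
Proof.
move=> ax X0 lX TX; split; first exact: connectification_no_compact_component.
move=> nC; have [i6|i6] := pselect (i = T6); last first.
  exact: noncompact_connectification.
case: ax => [//|[MA nCH]]; subst i; case: (TX) => nX aX GX.
have [crX _] := Ti_completely_regular TX.
have /choice[f fP] : forall D : set X, exists f : X -> RR,
    (exists x, D = connected_component setT x) -> [/\ continuous f,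
      forall y, (0 < f y)%R &
      forall e, (0 < e)%R -> exists2 y, D y & (f y < e)%R].
  move=> D; have [[x ->]|nD] :=
    pselect (exists x, D = connected_component setT x);
    last by exists (cst 0%R) => /nD.
  have clD : closed (connected_component setT x).
    exact/component_closed/closedT.
  have [|f fP] := positive_inf0_function nX aX clD; last by exists f.
  move=> ccD; apply: (nC x); apply: MA_countably_compact_compact => //.
    exact: (@completely_regular_regular RR).
  exact: Gdelta_open_Fsigma.
apply: (@positive_connectification X lX f) => // x.
by have [|cf fp fi] := fP (connected_component setT x); [exists x|split].
Qed.
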